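(* There is an absolute constant $C$ such that for every $n\ge 2$, any family $\mathcal{F}$ of $n$ closed discs in the plane (discs of radius $0$, i.e. points, allowed) can be colored with at most $C\log n$ colors so that for every closed disc $B$ in the plane (not necessarily in $\mathcal{F}$) for which $S_B=\{D\in\mathcal{F}: D\cap B\ne\emptyset\}$ is nonempty, $S_B$ contains an element whose color differs from the colors of all other elements of $S_B$. This bound is asymptotically tight: there is an absolute constant $c>0$ such that for every $n\ge 2$ there is a family of $n$ discs for which any coloring with this property uses at least $c\log n$ colors. *)

(* Defs.v *)
From Stdlib Require Import Reals.
Open Scope R_scope.

Record cdisc := mkCDisc { cx : R; cy : R; rad : R }.

Definition valid_disc (d : cdisc) : Prop := 0 <= rad d.

Definition in_disc (d : cdisc) (x y : R) : Prop :=
  (x - cx d) ^ 2 + (y - cy d) ^ 2 <= rad d ^ 2.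

Definition discs_meet (d e : cdisc) : Prop :=
  exists x y : R, in_disc d x y /\ in_disc e x y.

Definition disc_family (n : nat) (F : nat -> cdisc) : Prop :=
  (forall i, (i < n)%nat -> valid_disc (F i)) /\
  (forall i j, (i < n)%nat -> (j < n)%nat -> F i = F j -> i = j).

Definition coloring (n k : nat) (col : nat -> nat) : Prop :=
  forall i, (i < n)%nat -> (col i < k)%nat.

Definition cf_discs (n : nat) (F : nat -> cdisc) (col : nat -> nat) : Prop :=
  forall B : cdisc, valid_disc B ->
    (exists i, (i < n)%nat /\ discs_meet (F i) B) ->
    exists i, (i < n)%nat /\ discs_meet (F i) B /\
      forall j, (j < n)%nat -> discs_meet (F j) B -> j <> i -> col j <> col i.

(* Main.v *)
(* A disc with centre p and radius r meets D_i iff f_i(p) <= r, where f_i(p) = |p - c_i| - r_i. Call two discs adjacent if at some point p their values f_i(p), f_j(p) are smaller than those of all the others. Perturbing p shows that a disc meeting at least two members of the family meets both ends of an adjacent pair. Each edge can be drawn as the path c_i - p - c_j, on which f_i or f_j stays the smallest by a fixed margin, so paths without a common end keep apart.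

   Hence the adjacency graph has no K_5 minor: after a small perturbation into general position, such a minor would give a drawing of K_5 by polygonal paths in which independent edges do not cross, and counting crossings modulo 2 forbids this. By Mader's argument a graph without K_5 minor is sparse in every subset, so it has an independent set containing a fixed fraction of the vertices. Giving this set a new colour and repeating on the rest uses O(log n) colours, and among the discs met by B the last removed ones form a single disc.

   For the lower bound, take n points on a line: the discs cut out all intervals, and splitting at the uniquely coloured point shows that k colours handle fewer than 2^k points. *)
Require Import Defs.
From mathcomp Require all_boot zify.
From Stdlib Require Import Reals Lra Lia Psatz Classical ClassicalEpsilon.
Open Scope R_scope.

(** * Complete minors of dense graphs, independent sets of sparse ones *)

(* The MathComp notations are imported only inside the modules, so that [<=] on [nat] in the theorem is the Peano order and not the boolean one. *)
Module Minor.
Import all_boot zify.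
Set Implicit Arguments.
Unset Strict Implicit.
Unset Printing Implicit Defensive.
Local Open Scope nat_scope.

Section CliqueMinor.

Variables (T : finType) (e : rel T).
Hypothesis e_sym : symmetric e.

Definition inside (X : {set T}) : rel T :=
  [rel x y | [&& x \in X, y \in X & e x y]].

Lemma disjointsUl (X Y Z : {set T}) :
  [disjoint X :|: Y & Z] = [disjoint X & Z] && [disjoint Y & Z].
Proof. by rewrite -!setI_eq0 setIUl setU_eq0. Qed.

Definition conn (X : {set T}) : Prop :=
  forall x y, x \in X -> y \in X -> connect (inside X) x y.

Definition touch (X Y : {set T}) : Prop :=
  exists x y, [/\ x \in X, y \in Y & e x y].

(** The sets of [s] are the branch sets of a complete minor of [e], one for each vertex of the
    clique. *)
Fixpoint clique_model (s : seq {set T}) : Prop :=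
  if s is X :: s' then
    [/\ conn X, forall Y, Y \in s' -> [disjoint X & Y] /\ touch X Y
      & clique_model s']
  else True.

(** Pairs are ordered, so an edge counts twice and the cardinal is the sum of the degrees. *)
Definition arcs (V : {set T}) (g : rel T) : {set T * T} :=
  [set p | [&& p.1 \in V, p.2 \in V & g p.1 p.2]].

Definition nbrs (V : {set T}) (g : rel T) (x : T) : {set T} :=
  [set y in V | g x y].

Lemma in_arcs V g x y :
  ((x, y) \in arcs V g) = [&& x \in V, y \in V & g x y].
Proof. by rewrite inE. Qed.

Lemma in_nbrs V g x y : (y \in nbrs V g x) = (y \in V) && g x y.
Proof. by rewrite inE. Qed.

Definition graphE := (in_arcs, in_nbrs, inE).

Lemma card_arcs V g : #|arcs V g| = \sum_(x in V) #|nbrs V g x|.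
Proof.
rewrite -sum1_card.
under [RHS]eq_bigr => x xV do rewrite -sum1_card.
rewrite pair_big_dep /=; apply: eq_bigl => -[x y].
by rewrite in_arcs in_nbrs.
Qed.

Lemma connect_inside_sub (X Y : {set T}) x y : X \subset Y ->
  connect (inside X) x y -> connect (inside Y) x y.
Proof.
move=> /subsetP sXY; apply: connect_sub => a b /and3P[aX bX ab].
by apply: connect1; apply/and3P; split; rewrite ?sXY.
Qed.

Lemma conn_setU X Y : conn X -> conn Y -> touch X Y -> conn (X :|: Y).
Proof.
move=> cX cY [a [b [aX bY ab]]].
have sX := subsetUl X Y; have sY := subsetUr X Y.
have lX x y : x \in X -> y \in X -> connect (inside (X :|: Y)) x y.
  by move=> xX yX; apply: (connect_inside_sub sX); apply: cX.
have lY x y : x \in Y -> y \in Y -> connect (inside (X :|: Y)) x y.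
  by move=> xX yX; apply: (connect_inside_sub sY); apply: cY.
have cab : connect (inside (X :|: Y)) a b.
  by apply: connect1; rewrite /inside /= !graphE aX bY ab orbT.
have cba : connect (inside (X :|: Y)) b a.
  by apply: connect1; rewrite /inside /= !graphE aX bY e_sym ab orbT.
move=> x y /setUP[xX|xY] /setUP[yX|yY]; [exact: lX| | |exact: lY].
- exact: connect_trans (lX _ _ xX aX) (connect_trans cab (lY _ _ bY yY)).
- exact: connect_trans (lY _ _ xY bY) (connect_trans cba (lX _ _ aX yX)).
Qed.

Lemma touch_sub (X Y X' Y' : {set T}) :
  X \subset X' -> Y \subset Y' -> touch X Y -> touch X' Y'.
Proof.
move=> /subsetP sX /subsetP sY [x [y [xX yY xy]]].
by exists x, y; split; [exact: sX|exact: sY|].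
Qed.

(** The graph [g] on [V] is a minor of [e], with [b x] as the branch set of [x]. Contractions keep
    the type [T] and only shrink [V]. *)
Definition blocks (V : {set T}) (g : rel T) (b : T -> {set T}) : Prop :=
  [/\ forall x, x \in V -> conn (b x),
      forall x y, x \in V -> y \in V -> x != y -> [disjoint b x & b y]
    & forall x y, x \in V -> y \in V -> g x y -> touch (b x) (b y)].

Definition contract_rel (g : rel T) (u v : T) : rel T :=
  [rel x y | (x != y) && [|| g x y, (x == u) && g v y | (y == u) && g x v]].

Definition contract_block (b : T -> {set T}) (u v : T) (x : T) : {set T} :=
  if x == u then b u :|: b v else b x.

Lemma contract_blocks (V : {set T}) (g : rel T) (b : T -> {set T}) u v :
  u \in V -> v \in V -> u != v -> g u v ->
  blocks V g b ->
  blocks (V :\ v) (contract_rel g u v) (contract_block b u v).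
Proof.
move=> uV vV uv guv [bc bd bt]; split.
- move=> x /setD1P[xv xV]; rewrite /contract_block.
  case: eqP => [_|_]; last exact: bc.
  by apply: conn_setU; [exact: bc|exact: bc|exact: bt].
- move=> x y /setD1P[xv xV] /setD1P[yv yV] xy; rewrite /contract_block.
  case: eqP => [xu|_]; case: eqP => [yu|_].
  + by rewrite xu yu eqxx in xy.
  + by subst x; rewrite disjointsUl ?bd // eq_sym.
  + by subst y; rewrite disjoint_sym disjointsUl ?bd // eq_sym.
  + exact: bd.
- have sub x : b x \subset contract_block b u v x.
    by rewrite /contract_block; case: eqP => [->|//]; rewrite subsetUl.
  have subv : b v \subset contract_block b u v u.
    by rewrite /contract_block eqxx subsetUr.
  move=> x y /setD1P[xv xV] /setD1P[yv yV]; rewrite /contract_rel /=.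
  case/andP=> _ /or3P[gxy|/andP[/eqP-> gvy]|/andP[/eqP-> gxv]].
  + exact: touch_sub (sub _) (sub _) (bt _ _ xV yV gxy).
  + exact: touch_sub subv (sub _) (bt _ _ vV yV gvy).
  + exact: touch_sub (sub _) subv (bt _ _ xV vV gxv).
Qed.

(** Renaming [v] to [u] sends the arcs outside [bad] injectively into the contracted graph. Lost are
    the edge [u v] and, for each common neighbour, one of two edges that become parallel, each in
    both directions. *)
Lemma card_arcs_contract (V : {set T}) (g : rel T) u v :
  symmetric g -> irreflexive g -> u \in V -> v \in V -> g u v ->
  #|arcs V g| <= #|arcs (V :\ v) (contract_rel g u v)| + 2
                 + 2 * #|nbrs V g u :&: nbrs V g v|.
Proof.
move=> gs gi uV vV guv.
have uv : u != v by apply: contraTneq guv => ->; rewrite gi.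
pose C := nbrs V g u :&: nbrs V g v.
pose bad : {set T * T} := [set (u, v); (v, u)]
  :|: ([set (v, z) | z in C] :|: [set (z, v) | z in C]).
have cbad : #|bad| <= 2 + 2 * #|C|.
  apply: leq_trans (leq_card_setU _ _) _; apply: leq_add.
    by rewrite cards2; case: (_ != _).
  apply: leq_trans (leq_card_setU _ _) _; rewrite mul2n -addnn.
  by apply: leq_add; apply: leq_imset_card.
pose k x := if x == v then u else x.
pose kk (p : T * T) := (k p.1, k p.2).
have good : #|arcs V g :\: bad| <= #|arcs (V :\ v) (contract_rel g u v)|.
  have kinj : {in arcs V g :\: bad &, injective kk}.
    move=> [x y] [x' y'] /setDP[+ Hb] /setDP[+ Hb'].
    rewrite /contract_rel !graphE /= => /and3P[xV yV gxy] /and3P[x'V y'V gxy'].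
    have inC z : z \in V -> g u z -> g v z -> z \in C.
      by move=> zV guz gvz; rewrite !graphE zV guz gvz.
    have nb z : z \in V -> g u z -> g v z -> (v, z) \in bad /\ (z, v) \in bad.
      move=> zV guz gvz; split; rewrite !graphE; apply/orP; right; apply/orP.
        by left; apply: imset_f; apply: inC.
      by right; apply/imsetP; exists z => //; apply: inC.
    have b1 : (u, v) \in bad by rewrite !graphE eqxx.
    have b2 : (v, u) \in bad by rewrite !graphE eqxx orbT.
    rewrite /kk /k /= => -[].
    case: (eqVneq x v) => [xv|xv]; case: (eqVneq x' v) => [xv'|xv'];
    case: (eqVneq y v) => [yv|yv]; case: (eqVneq y' v) => [yv'|yv'];
    move=> E1 E2; subst=> //; move: gxy gxy' Hb Hb'; rewrite ?gi ?b1 ?b2 // => gxy gxy' Hb Hb'.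
    + by have [N _] := nb _ yV gxy' gxy; rewrite N in Hb.
    + by have [N _] := nb _ y'V gxy gxy'; rewrite N in Hb'.
    + by move: Hb; rewrite gs in gxy; rewrite gs in gxy'; have [_ ->] := nb _ x'V gxy' gxy.
    + by move: Hb'; rewrite gs in gxy; rewrite gs in gxy'; have [_ ->] := nb _ x'V gxy gxy'.
  rewrite -(card_in_imset kinj); apply: subset_leq_card; apply/subsetP => q.
  case/imsetP => -[x y] /setDP[+ Hb] ->; rewrite /contract_rel !graphE /= => /and3P[xV yV gxy].
  have b1 : (u, v) \in bad by rewrite !graphE eqxx.
  have b2 : (v, u) \in bad by rewrite !graphE eqxx orbT.
  rewrite /kk /k /=; case: (eqVneq x v) => [xv|xv]; case: (eqVneq y v) => [yv|yv]; subst.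
  + by rewrite gi in gxy.
  + rewrite uv uV yv yV eqxx gxy /= ?orbT ?andbT /=.
    by apply: contraNneq Hb => <-.
  + rewrite uv uV xv xV eqxx gxy /= ?orbT ?andbT /=.
    by apply: contraNneq Hb => ->.
  + rewrite xv xV yv yV gxy /= andbT.
    by apply: contraTneq gxy => ->; rewrite gi.
have := cardsID bad (arcs V g).
have := subset_leq_card (subsetIr (arcs V g) bad).
rewrite -/C; lia.
Qed.

(* Mader's argument: either some contraction preserves the density, or every edge at a vertex [a] has at least [2 ^ r] common neighbours, and then the neighbourhood of [a] carries a model of the clique with one vertex less. *)
Lemma dense_clique_model r (V : {set T}) (g : rel T) (b : T -> {set T}) :
  symmetric g -> irreflexive g -> blocks V g b -> V != set0 ->
  2 ^ r * #|V| <= #|arcs V g| ->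
  exists s : seq {set T}, [/\ size s = r.+1, clique_model s
    & forall X, X \in s -> X \subset \bigcup_(x in V) b x
                           /\ exists2 v, v \in V & b v \subset X].
Proof.
elim: r V g b => [|r IHr] V g b gs gi gb V0 dens.
  have /set0Pn[x xV] := V0; exists [:: b x]; split=> //.
    by case: gb => bc _ _; split=> //; exact: bc.
  move=> X; rewrite graphE => /eqP->; split; first exact: bigcup_sup.
  by exists x.
have [n] := ubnP #|V|; elim: n V g b gs gi gb V0 dens => // n IHn V g b gs gi gb V0 dens ltVn.
have [[u v]|none] := pickP [pred p | (p \in arcs V g) &&
   (2 ^ r.+1 * #|V :\ p.2| <= #|arcs (V :\ p.2) (contract_rel g p.1 p.2)|)].
  rewrite !graphE /= => /andP[/and3P[uV vV guv] dens'].
  have uv : u != v by apply: contraTneq guv => ->; rewrite gi.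
  have cV := cardsD1 v V; rewrite vV in cV.
  have gs' : symmetric (contract_rel g u v).
    move=> x y; rewrite /contract_rel /= eq_sym (gs x y) (gs v y) (gs x v).
    by rewrite [_ && g y v || _]orbC.
  have gi' : irreflexive (contract_rel g u v) by move=> x; rewrite /contract_rel /= eqxx.
  have V'0 : V :\ v != set0 by apply/set0Pn; exists u; rewrite !graphE uv.
  have [|s [ss cs hs]] := IHn _ _ _ gs' gi' (contract_blocks uV vV uv guv gb) V'0 dens'.
    by rewrite cV in ltVn.
  exists s; split=> // X /hs[sX [w /setD1P[wv wV] bw]]; split.
    apply: subset_trans sX _; apply/bigcupsP => x /setD1P[_ xV].
    rewrite /contract_block; case: ifP => _; last exact: bigcup_sup.
    by rewrite subUset !bigcup_sup.
  exists w => //; apply: subset_trans bw; rewrite /contract_block.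
  by case: eqP => [->|//]; rewrite subsetUl.
(* Contracting [u v] does not keep the density, so it loses more than [2 ^ r.+1] arcs. With [c]
   common neighbours it loses at most [2 + 2 c], and parity gives [2 ^ r <= c]. *)
have common u v : u \in V -> v \in V -> g u v ->
    2 ^ r <= #|nbrs V g u :&: nbrs V g v|.
  move=> uV vV guv; have := none (u, v); rewrite !graphE /= uV vV guv /= => /negbT.
  rewrite -ltnNge; have := card_arcs_contract gs gi uV vV guv.
  have := cardsD1 v V; rewrite vV expnS => /= cV; move: dens; rewrite expnS cV mulnDr -!mulnA.
  move: (2 ^ r) (#|V :\ v|) => p q; move: (p * q) => pq {none IHr IHn cV}.
  by move: #|arcs V g| #|arcs _ _| #|_ :&: _| => x y z; lia.
have /card_gt0P[[a w] aw] : 0 < #|arcs V g|.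
  by apply: leq_trans dens; rewrite muln_gt0 expn_gt0 /= card_gt0.
move: aw; rewrite graphE /= => /and3P[aV wV gaw].
have [bc bd bt] := gb.
set N := nbrs V g a.
have sNV : {subset N <= V} by move=> x; rewrite graphE => /andP[].
have aN : a \notin N by rewrite graphE gi andbF.
have gbN : blocks N g b.
  split=> [x /sNV|x y /sNV xV /sNV yV|x y /sNV xV /sNV yV].
  - exact: bc.
  - exact: bd.
  - exact: bt.
have N0 : N != set0 by apply/set0Pn; exists w; rewrite graphE wV.
(* Common neighbours with [a] lie in [N], so every vertex of [N] has at least [2 ^ r] neighbours
   there. *)
have densN : 2 ^ r * #|N| <= #|arcs N g|.
  rewrite card_arcs mulnC -sum_nat_const; apply: leq_sum => x.
  rewrite graphE => /andP[xV gax]; apply: leq_trans (common _ _ aV xV gax) _.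
  by apply: subset_leq_card; apply/subsetP => y; rewrite !graphE => /andP[-> /andP[_ ->]].
have [s [ss cs hs]] := IHr _ _ _ gs gi gbN N0 densN.
exists (b a :: s); split=> /=; first by rewrite ss.
- split=> //; first exact: bc.
  move=> Y /hs[sY [y yN bY]]; split.
    rewrite disjoint_sym; apply: disjointWl sY _.
    rewrite -setI_eq0 -subset0; apply/subsetP => z /setIP[/bigcupP[x xN zx] za].
    have ax : x != a by apply: contraNneq aN => <-.
    by have := bd _ _ (sNV _ xN) aV ax; move/disjointFr => /(_ _ zx); rewrite za.
  apply: touch_sub (bt a y aV (sNV _ yN) _) => //.
  by move: yN; rewrite graphE => /andP[].
- move=> X; rewrite graphE => /orP[/eqP->|/hs[sX [y yN bY]]].
    by split; [exact: bigcup_sup|exists a].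
  split; last by exists y => //; exact: sNV.
  apply: subset_trans sX _; apply/bigcupsP => x xN.
  by apply: bigcup_sup; exact: sNV.
Qed.

(** Greedy choice: the degree sum is below [d * #|V|], so some vertex has fewer than [d] neighbours.
    It enters [I], and it is deleted together with its neighbours, at most [d] vertices in all;
    subsets of the rest are still sparse. *)
Lemma sparse_independent d (V : {set T}) : irreflexive e ->
  (forall Q : {set T}, Q \subset V -> Q != set0 -> #|arcs Q e| < d * #|Q|) ->
  exists I : {set T}, [/\ I \subset V, {in I &, forall x y, ~~ e x y}
                        & #|V| <= d * #|I|].
Proof.
move=> ei; have [n] := ubnP #|V|; elim: n V => // n IH V ltV sparse.
have [->|V0] := eqVneq V set0.
  by exists set0; split; rewrite ?sub0set ?cards0 // => x y; rewrite graphE.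
have [v vV degv] : exists2 v, v \in V & #|nbrs V e v| < d.
  apply/exists_inP; rewrite -[X in is_true X]negbK negb_exists_in.
  apply/negP => /forall_inP big; have := sparse V (subxx _) V0.
  rewrite ltnNge card_arcs mulnC -sum_nat_const; apply/negP/negPn.
  by apply: leq_sum => x /big; rewrite -leqNgt.
have vN : v \notin nbrs V e v by rewrite graphE ei andbF.
set R := v |: nbrs V e v.
have cR : #|R| <= d by rewrite cardsU1 vN.
have RV : R \subset V.
  by apply/subsetP => x /setU1P[->//|]; rewrite graphE => /andP[].
have cVR : #|V :\: R| + #|R| = #|V|.
  by rewrite cardsD (setIidPr RV) subnK // subset_leq_card.
have R1 : 0 < #|R| by apply/card_gt0P; exists v; rewrite setU11.
have [||I [sI indI cI]] := IH (V :\: R).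
- lia.
- by move=> Q sQ; apply: sparse; apply: subset_trans sQ (subsetDl _ _).
have vI : v \notin I.
  by apply/negP => /(subsetP sI); rewrite !graphE eqxx.
have nv x : x \in I -> ~~ e v x.
  move=> /(subsetP sI); rewrite !graphE negb_or => /andP[/andP[_ +] xV].
  by rewrite xV.
exists (v |: I); split.
- by rewrite subUset sub1set vV; apply: subset_trans sI (subsetDl _ _).
- move=> x y /setU1P[->|xI] /setU1P[->|yI]; rewrite ?ei ?nv //; last exact: indI.
  by rewrite e_sym nv.
- rewrite cardsU1 vI mulnDr muln1; lia.
Qed.

Lemma no_K5_independent (V : {set T}) : irreflexive e ->
  (forall s, size s = 5 -> (forall X, X \in s -> X != set0 /\ X \subset V) ->
     ~ clique_model s) ->
  exists I : {set T}, [/\ I \subset V, {in I &, forall x y, ~~ e x y}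
                        & #|V| <= 16 * #|I|].
Proof.
move=> ei noK5; apply: sparse_independent => // Q sQ Q0; rewrite ltnNge; apply/negP => dens.
have gb : blocks Q e set1.
  split=> [x _ y z /set1P-> /set1P->|x y _ _ xy|x y _ _ xy]; first exact: connect0.
    by rewrite disjoints1 graphE.
  by exists x, y; rewrite !set11.
(* The value [r = 4] gives five branch sets and the threshold [2 ^ 4 = 16]. *)
have [s [ss cs hs]] := dense_clique_model (r := 4) e_sym ei gb Q0 dens.
apply: (noK5 s ss _ cs) => X /hs[sX [v vQ]]; rewrite sub1set => vX; split.
  by apply/set0Pn; exists v.
apply: subset_trans sX _; apply/bigcupsP => x xQ; rewrite sub1set.
exact: (subsetP sQ).
Qed.

End CliqueMinor.
End Minor.

(** * Orientations of points in the plane and parity of crossings *)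

Module Parity.
Import all_boot zify.
Set Implicit Arguments.
Unset Strict Implicit.
Unset Printing Implicit Defensive.
Local Open Scope R_scope.

Definition pos (x : R) : bool := if Rlt_dec 0 x then true else false.

Lemma posP (x : R) : reflect (0 < x) (pos x).
Proof. by rewrite /pos; case: Rlt_dec => h; constructor. Qed.

Lemma pos_opp (x : R) : x <> 0 -> pos (- x) = ~~ pos x.
Proof. by move=> x0; case: posP; case: posP => //=; lra. Qed.

Lemma pos_mul (x y : R) : x <> 0 -> y <> 0 ->
  if pos x == pos y then 0 < x * y else x * y < 0.
Proof. by move=> x0 y0; case: posP; case: posP => /=; nra. Qed.

(** Twice the signed area of the triangle [p q r]. *)
Definition det (p q r : R * R) : R :=
  (q.1 - p.1) * (r.2 - p.2) - (q.2 - p.2) * (r.1 - p.1).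

Section Crossings.

Variables (X : eqType) (pt : X -> R * R).
Hypothesis generic : forall a b c, uniq [:: a; b; c] -> det (pt a) (pt b) (pt c) <> 0.

Definition ccw (a b c : X) : bool := pos (det (pt a) (pt b) (pt c)).

Lemma ccw_rot a b c : ccw b c a = ccw a b c.
Proof. by rewrite /ccw; congr pos; rewrite /det; ring. Qed.

Lemma ccw_swap a b c : uniq [:: a; b; c] -> ccw b a c = ~~ ccw a b c.
Proof.
by move/generic => h; rewrite /ccw -pos_opp //; congr pos; rewrite /det; ring.
Qed.

Definition not_all_equal (x y z : bool) : bool := ~~ ((x == y) && (y == z)).

(** The four determinants, taken with alternating signs, add up to zero, so the signed terms are
    neither all positive nor all negative. *)
Lemma ccw4 a b c d : uniq [:: a; b; c; d] ->
  ~~ [&& ccw b c d, ~~ ccw a c d, ccw a b d & ~~ ccw a b c] &&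
  ~~ [&& ~~ ccw b c d, ccw a c d, ~~ ccw a b d & ccw a b c].
Proof.
move=> u; have sel m : uniq (mask m [:: a; b; c; d]) by apply: mask_uniq.
have h1 := generic (sel [:: true; true; true]).
have h2 := generic (sel [:: true; true; false; true]).
have h3 := generic (sel [:: true; false; true; true]).
have h4 := generic (sel [:: false; true; true; true]).
have E : det (pt b) (pt c) (pt d) - det (pt a) (pt c) (pt d)
       + det (pt a) (pt b) (pt d) - det (pt a) (pt b) (pt c) = 0.
  by rewrite /det; ring.
by rewrite /ccw; case: posP; case: posP; case: posP; case: posP => //=; lra.
Qed.

(* The signs in the three-term Grassmann-Pluecker relation with pivot [a]. *)
Lemma ccw5 a b c d e : uniq [:: a; b; c; d; e] ->
  not_all_equal (ccw a b c == ccw a d e) (ccw a b d != ccw a c e)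
                (ccw a b e == ccw a c d).
Proof.
rewrite /= !inE !negb_or => /and5P[/and4P[ab ac ad ae] /and3P[bc bd be] /andP[cd ce] de _].
have g x y : a != x -> a != y -> x != y -> det (pt a) (pt x) (pt y) <> 0.
  by move=> ax ay xy; apply: generic; rewrite /= !inE negb_or ax ay xy.
have := pos_mul (g b c ab ac bc) (g d e ad ae de).
have := pos_mul (g b d ab ad bd) (g c e ac ae ce).
have := pos_mul (g b e ab ae be) (g c d ac ad cd).
rewrite /not_all_equal -!/(ccw _ _ _).
have : det (pt a) (pt b) (pt c) * det (pt a) (pt d) (pt e)
     - det (pt a) (pt b) (pt d) * det (pt a) (pt c) (pt e)
     + det (pt a) (pt b) (pt e) * det (pt a) (pt c) (pt d) = 0.
  by rewrite /det; ring.
by do 3 case: (_ == _) => //=; lra.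
Qed.

(** Proper crossing of the segments [a b] and [c d], expressed by orientations alone so that parity
    claims become Boolean. *)
Definition crosses (a b c d : X) : bool :=
  (ccw a b c != ccw a b d) && (ccw c d a != ccw c d b).

Definition in_triangle (a b c d : X) : bool :=
  (ccw a b d == ccw b c d) && (ccw b c d == ccw c a d).

Lemma ccw_perm a b c : uniq [:: a; b; c] ->
  (ccw b c a = ccw a b c) * (ccw c a b = ccw a b c) * (ccw b a c = ~~ ccw a b c)
  * (ccw a c b = ~~ ccw a b c) * (ccw c b a = ~~ ccw a b c).
Proof.
move=> u; have u' : uniq [:: b; c; a] by rewrite -(rot_uniq 1) in u.
have u'' : uniq [:: c; a; b] by rewrite -(rot_uniq 2) in u.
split; last by rewrite (ccw_swap u') (ccw_rot a b c).
split; last by rewrite (ccw_swap u'') (ccw_rot c a b).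
split; last exact: ccw_swap.
by split; [exact: ccw_rot | exact/esym/ccw_rot].
Qed.

(** Both claims depend only on the orientations of the ten triples and hold for each sign pattern
    that [ccw4] and [ccw5] allow. The first says that [d e] crosses the boundary of a triangle oddly
    iff exactly one end is inside; the second, that a straight drawing of K_5 has an odd number of
    crossings. *)
Lemma five_points a b c d e : uniq [:: a; b; c; d; e] ->
  (crosses a b d e (+) crosses b c d e (+) crosses c a d e =
   in_triangle a b c d (+) in_triangle a b c e) /\
  crosses a b c d (+) crosses a b c e (+) crosses a b d e
  (+) crosses a c b d (+) crosses a c b e (+) crosses a c d e
  (+) crosses a d b c (+) crosses a d b e (+) crosses a d c e
  (+) crosses a e b c (+) crosses a e b d (+) crosses a e c d
  (+) crosses b c d e (+) crosses b d c e (+) crosses b e c d.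
Proof.
move=> u.
have sel m : uniq (mask m [:: a; b; c; d; e]) by apply: mask_uniq.
have perm s : perm_eq s [:: a; b; c; d; e] -> uniq s by move/perm_uniq->.
have ub : uniq [:: b; a; c; d; e].
  by apply: perm; apply/permP => p /=; lia.
have uc : uniq [:: c; a; b; d; e].
  by apply: perm; apply/permP => p /=; lia.
have ud : uniq [:: d; a; b; c; e].
  by apply: perm; apply/permP => p /=; lia.
have ue : uniq [:: e; a; b; c; d].
  by apply: perm; apply/permP => p /=; lia.
have := ccw5 u; have := ccw5 ub; have := ccw5 uc; have := ccw5 ud; have := ccw5 ue.
have := ccw4 (sel [:: true; true; true; true]).
have := ccw4 (sel [:: true; true; true; false; true]).
have := ccw4 (sel [:: true; true; false; true; true]).
have := ccw4 (sel [:: true; false; true; true; true]).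
have := ccw4 (sel [:: false; true; true; true; true]).
rewrite /crosses /in_triangle.
have P1 := ccw_perm (sel [:: true; true; true]).
have P2 := ccw_perm (sel [:: true; true; false; true]).
have P3 := ccw_perm (sel [:: true; true; false; false; true]).
have P4 := ccw_perm (sel [:: true; false; true; true]).
have P5 := ccw_perm (sel [:: true; false; true; false; true]).
have P6 := ccw_perm (sel [:: true; false; false; true; true]).
have P7 := ccw_perm (sel [:: false; true; true; true]).
have P8 := ccw_perm (sel [:: false; true; true; false; true]).
have P9 := ccw_perm (sel [:: false; true; false; true; true]).
have P10 := ccw_perm (sel [:: false; false; true; true; true]).
(* Every orientation is reduced to one of the ten sorted triples, which leaves [2 ^ 10] cases. *)
rewrite !(P1, P2, P3, P4, P5, P6, P7, P8, P9, P10).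
move: (ccw a b c) (ccw a b d) (ccw a b e) (ccw a c d) (ccw a c e)
  (ccw a d e) (ccw b c d) (ccw b c e) (ccw b d e) (ccw c d e).
clear.
by do 10 case; vm_compute.
Qed.

Lemma crosses_sym a b c d : crosses a b c d = crosses c d a b.
Proof. by rewrite /crosses andbC. Qed.

Lemma crosses_flat a d e : crosses a a d e = false.
Proof.
have flat x : ccw a a x = false.
  by apply/posP; rewrite /det !Rminus_diag; lra.
by rewrite /crosses !flat.
Qed.

Lemma crosses_swap a b d e : d \notin [:: a; b] -> e \notin [:: a; b] ->
  crosses b a d e = crosses a b d e.
Proof.
have [->//|ab] := eqVneq a b; rewrite !inE !negb_or => /andP[da db] /andP[ea eb].
rewrite /crosses [ccw d e b == _]eq_sym.
have swap x : x != a -> x != b -> ccw b a x = ~~ ccw a b x.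
  by move=> xa xb; apply: ccw_swap; rewrite /= !inE negb_or ab eq_sym xa eq_sym xb.
by rewrite !swap // (inj_eq negb_inj).
Qed.

Lemma crosses_swapr a b d e : a \notin [:: d; e] -> b \notin [:: d; e] ->
  crosses a b e d = crosses a b d e.
Proof. by move=> ha hb; rewrite crosses_sym crosses_swap // crosses_sym. Qed.

(** Coning a polygon from one of its own nodes produces triangles with repeated vertices; these
    count as empty. *)
Definition weak_in_triangle a b c d := uniq [:: a; b; c] && in_triangle a b c d.

(** If two vertices coincide, the flat side crosses nothing and the other two sides cancel modulo
    2. *)
Lemma triangle_crossings a b c d e :
  d \notin [:: a; b; c] -> e \notin [:: a; b; c] ->
  crosses a b d e (+) crosses b c d e (+) crosses c a d e =
  weak_in_triangle a b c d (+) weak_in_triangle a b c e.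
Proof.
have [<- _ _|de] := eqVneq d e.
  by rewrite addbb /crosses !eqxx.
move=> hd he; rewrite /weak_in_triangle.
have [u|] := boolP (uniq [:: a; b; c]).
  have u5 : uniq [:: a; b; c; d; e].
    by rewrite -[[:: a; b; c; d; e]]/([:: a; b; c] ++ [:: d; e]) cat_uniq u /=
      (negbTE hd) (negbTE he) inE de.
  exact: (five_points u5).1.
move: hd he; rewrite !inE !negb_or => /and3P[da db dc] /and3P[ea eb ec].
have sw x y : d != x -> d != y -> e != x -> e != y -> crosses x y d e = crosses y x d e.
  by move=> *; apply: crosses_swap; rewrite !inE negb_or; apply/andP; split.
rewrite /= !inE andbT negb_and !negbK => /orP[/orP[]|] /eqP E; subst.
- by rewrite crosses_flat (sw c) // addFb addbb.
- by rewrite crosses_flat (sw b) // addbF addbb.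
- by rewrite crosses_flat (sw c) // addbF addbb.
Qed.

(** * Parity of crossings between closed polygons *)

Definition steps (x : X) (p : seq X) : seq (X * X) := zip (x :: p) p.

Lemma steps_cons x y p : steps x (y :: p) = (x, y) :: steps y p.
Proof. by []. Qed.

Lemma steps_rcons x p y : steps x (rcons p y) = rcons (steps x p) (last x p, y).
Proof. by elim: p x => //= z p IH x; rewrite !steps_cons IH. Qed.

Lemma mem_steps x p s : s \in steps x p -> (s.1 \in x :: p) /\ (s.2 \in x :: p).
Proof.
elim: p x => //= z p IH x; rewrite steps_cons inE => /orP[/eqP->|/IH[h1 h2]] /=.
  by rewrite !inE !eqxx ?orbT.
by split; apply/orP; right.
Qed.

Lemma steps_telescope (h : X -> bool) x p :
  \big[addb/false]_(s <- steps x p) (h s.1 (+) h s.2) = h x (+) h (last x p).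
Proof.
elim: p x => [|z p IH] x; first by rewrite big_nil addbb.
by rewrite steps_cons big_cons IH /= addbA addbK.
Qed.

Definition chain_crossings (S R : seq (X * X)) : bool :=
  \big[addb/false]_(s <- S) \big[addb/false]_(t <- R) crosses s.1 s.2 t.1 t.2.

Lemma chain_crossings_sym S R : chain_crossings S R = chain_crossings R S.
Proof.
rewrite /chain_crossings exchange_big; apply: eq_bigr => s _.
by apply: eq_bigr => t _; rewrite crosses_sym.
Qed.

Lemma chain_crossings_rcons S s R : chain_crossings (rcons S s) R =
  chain_crossings S R (+) chain_crossings [:: s] R.
Proof. by rewrite -cats1 /chain_crossings big_cat. Qed.

Lemma chain_crossings_rconsr S R s : chain_crossings S (rcons R s) =
  chain_crossings S R (+) chain_crossings S [:: s].
Proof. by rewrite !(chain_crossings_sym S) chain_crossings_rcons. Qed.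

(* Cone the first polygon off from its base point [x]: the parity with which it meets a segment is then the change of a winding parity along that segment, and this sums to zero around the second polygon. *)
Lemma closed_chain_crossings x p y q :
  last x p = x -> last y q = y -> ~~ has (mem (x :: p)) (y :: q) ->
  chain_crossings (steps x p) (steps y q) = false.
Proof.
move=> xp yq /hasPn dis.
pose wind d := \big[addb/false]_(s <- steps x p) weak_in_triangle x s.1 s.2 d.
rewrite chain_crossings_sym /chain_crossings.
transitivity (\big[addb/false]_(t <- steps y q) (wind t.1 (+) wind t.2)); last first.
  by rewrite steps_telescope yq addbb.
apply: eq_big_seq => -[d e] /mem_steps[/= /dis hd /dis he].
rewrite -big_split /=.
(* Crossings with the spoke from [x] to [z]. Each cone triangle has two spokes, and around the
   closed polygon they cancel. *)
pose h z := crosses x z d e.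
transitivity (\big[addb/false]_(s <- steps x p)
   ((weak_in_triangle x s.1 s.2 d (+) weak_in_triangle x s.1 s.2 e)
    (+) (h s.1 (+) h s.2))); last first.
  by rewrite big_split /= steps_telescope xp addbb addbF.
apply: eq_big_seq => -[a b] /mem_steps[/= ha hb].
have out z w : z \notin x :: p -> w \in x :: p -> z != w.
  by move=> hz hw; apply: contraNneq hz => ->.
have hx : x \in x :: p by rewrite inE eqxx.
rewrite -triangle_crossings; last 2 first.
- by rewrite !inE !negb_or !out.
- by rewrite !inE !negb_or !out.
rewrite crosses_sym /h [crosses b x d e]crosses_swap; last 2 first.
- by rewrite !inE !negb_or !out.
- by rewrite !inE !negb_or !out.
by case: (crosses x a d e); case: (crosses a b d e); case: (crosses x b d e).
Qed.

(** * The parity obstruction to drawing K_5 *)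

Lemma odd_addF m n : ~~ odd m -> ~~ odd n -> ~~ odd (m + n).
Proof. by rewrite oddD => /negbTE-> /negbTE->. Qed.

Definition independent i j k l : bool :=
  [&& i < j, k < l, j < 5, l < 5, i != k, i != l, j != k & j != l]%N.

(* The ten triangle relations add up to the sum of all [m], since each [s] occurs in two of them; the fifteen pair relations add up to the sum of all [m] and all [s]. *)
Lemma K5_parity_system (m s : nat -> nat -> nat -> nat -> bool) : (
  (forall i j k l, s i j k l = s k l i j) ->
  (forall i j k l, independent i j k l ->
     m i j k l (+) m k l i j (+) s i j k l = false) ->
  (forall i j k l n,
     independent i j k l -> independent i j l n -> independent i j k n ->
     m i j k l (+) m i j l n (+) m i j k n
     (+) s i j k l (+) s i j l n (+) s i j k n = false) ->
  ~~ odd (s 0 1 2 3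
  + s 0 1 2 4
  + s 0 1 3 4
  + s 0 2 1 3
  + s 0 2 1 4
  + s 0 2 3 4
  + s 0 3 1 2
  + s 0 3 1 4
  + s 0 3 2 4
  + s 0 4 1 2
  + s 0 4 1 3
  + s 0 4 2 3
  + s 1 2 3 4
  + s 1 3 2 4
  + s 1 4 2 3))%N.
Proof.
move=> sC mm mt.
have {}mm i j k l : independent i j k l ->
    ~~ odd (m i j k l + m k l i j + s i j k l).
  by move=> ind; rewrite !oddD !oddb mm.
have {}mt i j k l n : independent i j k l -> independent i j l n ->
    independent i j k n ->
    ~~ odd (m i j k l + m i j l n + m i j k n + s i j k l + s i j l n + s i j k n).
  by move=> h1 h2 h3; rewrite !oddD !oddb mt.
have h0 := mt 0%N 1%N 2%N 3%N 4%N isT isT isT.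
have h1 := mt 0%N 2%N 1%N 3%N 4%N isT isT isT.
have h2 := mt 0%N 3%N 1%N 2%N 4%N isT isT isT.
have h3 := mt 0%N 4%N 1%N 2%N 3%N isT isT isT.
have h4 := mt 1%N 2%N 0%N 3%N 4%N isT isT isT.
have h5 := mt 1%N 3%N 0%N 2%N 4%N isT isT isT.
have h6 := mt 1%N 4%N 0%N 2%N 3%N isT isT isT.
have h7 := mt 2%N 3%N 0%N 1%N 4%N isT isT isT.
have h8 := mt 2%N 4%N 0%N 1%N 3%N isT isT isT.
have h9 := mt 3%N 4%N 0%N 1%N 2%N isT isT isT.
have h10 := mm 0%N 1%N 2%N 3%N isT.
have h11 := mm 0%N 1%N 2%N 4%N isT.
have h12 := mm 0%N 1%N 3%N 4%N isT.
have h13 := mm 0%N 2%N 1%N 3%N isT.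
have h14 := mm 0%N 2%N 1%N 4%N isT.
have h15 := mm 0%N 2%N 3%N 4%N isT.
have h16 := mm 0%N 3%N 1%N 2%N isT.
have h17 := mm 0%N 3%N 1%N 4%N isT.
have h18 := mm 0%N 3%N 2%N 4%N isT.
have h19 := mm 0%N 4%N 1%N 2%N isT.
have h20 := mm 0%N 4%N 1%N 3%N isT.
have h21 := mm 0%N 4%N 2%N 3%N isT.
have h22 := mm 1%N 2%N 3%N 4%N isT.
have h23 := mm 1%N 3%N 2%N 4%N isT.
have h24 := mm 1%N 4%N 2%N 3%N isT.
(* In this sum of 25 even numbers each [m] occurs twice and, after [sC], each [s] three times. *)
have := ((odd_addF h0 (odd_addF h1 (odd_addF h2 (odd_addF h3 (odd_addF h4 (odd_addF h5 (odd_addF h6 (odd_addF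
h7 (odd_addF h8 (odd_addF h9 (odd_addF h10 (odd_addF h11 (odd_addF h12 (odd_addF h13 (odd_addF h14 (odd_addF h15 (odd_addF
h16 (odd_addF h17 (odd_addF h18 (odd_addF h19 (odd_addF h20 (odd_addF h21 (odd_addF h22 (odd_addF h23
h24))))))))))))))))))))))))).
rewrite (sC 2%N 3%N 0%N 1%N) (sC 2%N 4%N 0%N 1%N) (sC 3%N 4%N 0%N 1%N) (sC 1%N
3%N 0%N 2%N) (sC 1%N 4%N 0%N 2%N) (sC 3%N 4%N 0%N 2%N) (sC 1%N 2%N 0%N 3%N)
(sC 1%N 4%N 0%N 3%N) (sC 2%N 4%N 0%N 3%N) (sC 1%N 2%N 0%N 4%N) (sC 1%N 3%N 0%N
4%N) (sC 2%N 3%N 0%N 4%N) (sC 3%N 4%N 1%N 2%N) (sC 2%N 4%N 1%N 3%N) (sC 2%N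
3%N 1%N 4%N).
clear.
repeat match goal with |- context [nat_of_bool ?b] => move: (nat_of_bool b) => ? end.
lia.
Qed.

Section Drawing.

Variables (v : nat -> X) (w : nat -> nat -> seq X).

Hypothesis w_last : forall i j, (i < j < 5)%N -> last (v i) (w i j) = v j.
Hypothesis w_disjoint : forall i j k l, independent i j k l ->
  ~~ has (mem (v i :: w i j)) (v k :: w k l).
Hypothesis w_cross : forall i j k l, independent i j k l ->
  chain_crossings (steps (v i) (w i j)) (steps (v k) (w k l)) = false.

(** Polygonal edges are compared with their straight chords: [m] pairs a polygon with a chord, [s]
    pairs two chords. *)
Let m i j k l := chain_crossings (steps (v i) (w i j)) [:: (v k, v l)].
Let s i j k l := crosses (v i) (v j) (v k) (v l).

Lemma v_in_w i j : (i < j < 5)%N ->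
  (v i \in v i :: w i j) /\ (v j \in v i :: w i j).
Proof. by move=> ij; rewrite inE eqxx -(w_last ij) mem_last. Qed.

Lemma independent_neq i j k l z : independent i j k l ->
  z \in v i :: w i j -> (z != v k) /\ (z != v l).
Proof.
move=> ind hz; have dis := w_disjoint ind.
have /andP[/andP[ij kl] h5] : ((i < j < 5) && (k < l < 5) && true)%N.
  by move: ind; rewrite /independent; lia.
have [k1 l1] := v_in_w kl.
by split; apply: contraNneq dis => E; apply/hasP; [exists (v k)|exists (v l)];
  rewrite //= -?E.
Qed.

Lemma m_swap i j k l : independent i j k l -> m i j l k = m i j k l.
Proof.
move=> ind; apply: eq_big_seq => -[a b] /mem_steps[/= ha hb].
rewrite /= !big_seq1 /=; apply: crosses_swapr; rewrite !inE negb_or.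
  by have [-> ->] := independent_neq ind ha.
by have [-> ->] := independent_neq ind hb.
Qed.

Lemma ends_notin i j k l : independent i j k l ->
  (v k \notin [:: v i; v j]) * (v l \notin [:: v i; v j])
  * (v i \notin [:: v k; v l]) * (v j \notin [:: v k; v l]).
Proof.
move=> ind; have ij : (i < j < 5)%N by move: ind; rewrite /independent; lia.
have [hi hj] := v_in_w ij.
have [ik il] := independent_neq ind hi; have [jk jl] := independent_neq ind hj.
by rewrite !inE !negb_or ![v k == _]eq_sym ![v l == _]eq_sym ik il jk jl.
Qed.

Lemma s_swapl i j k l : independent i j k l ->
  crosses (v j) (v i) (v k) (v l) = s i j k l.
Proof. by move=> /ends_notin h; apply: crosses_swap; rewrite h. Qed.

Lemma s_swap2 i j k l : independent i j k l ->
  crosses (v j) (v i) (v l) (v k) = s i j k l.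
Proof.
move=> ind; rewrite -(s_swapl ind); apply: crosses_swapr.
  by rewrite (ends_notin ind).
by rewrite (ends_notin ind).
Qed.

Lemma closed_step i j : (i < j < 5)%N ->
  steps (v i) (rcons (w i j) (v i)) = rcons (steps (v i) (w i j)) (v j, v i).
Proof. by move=> ij; rewrite steps_rcons w_last. Qed.

Lemma mem_closed i j : (i < j < 5)%N ->
  v i :: rcons (w i j) (v i) =i v i :: w i j.
Proof. by move=> ij z; rewrite !inE mem_rcons inE; case: eqP. Qed.

(** Closed up by their chords, the two polygons share no node and cross evenly. Of the four
    contributions the one of polygon with polygon vanishes by [w_cross]. *)
Lemma walk_walk i j k l : independent i j k l ->
  m i j k l (+) m k l i j (+) s i j k l = false.
Proof.
move=> ind; have ind' : independent k l i j by move: ind; rewrite /independent; lia.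
have ij : (i < j < 5)%N by move: ind; rewrite /independent; lia.
have kl : (k < l < 5)%N by move: ind; rewrite /independent; lia.
have := @closed_chain_crossings (v i) (rcons (w i j) (v i)) (v k) (rcons (w k l) (v k)).
rewrite !last_rcons => /(_ erefl erefl).
rewrite (eq_has_r (mem_closed kl)) (eq_has (a2 := mem (v i :: w i j))); last exact: mem_closed.
move=> /(_ (w_disjoint ind)).
rewrite !closed_step // chain_crossings_rcons !chain_crossings_rconsr w_cross // addFb.
rewrite [chain_crossings [:: _] (steps _ _)]chain_crossings_sym.
rewrite -/(m i j l k) -/(m k l j i) (m_swap ind) (m_swap ind') /chain_crossings !big_seq1 /=.
by rewrite (s_swap2 ind) addbA.
Qed.

(** The closed-up polygon of [i j] is set against the triangle on the other three vertices. *)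
Lemma walk_triangle i j k l n :
  independent i j k l -> independent i j l n -> independent i j k n ->
  m i j k l (+) m i j l n (+) m i j k n
  (+) s i j k l (+) s i j l n (+) s i j k n = false.
Proof.
move=> kl ln kn.
have ij : (i < j < 5)%N by move: kl; rewrite /independent; lia.
have out z : z \in v i :: w i j -> z \notin [:: v k; v l; v n; v k].
  move=> hz; have [h1 h2] := independent_neq kl hz.
  by have [_ h3] := independent_neq kn hz; rewrite !inE !negb_or h1 h2 h3.
have := @closed_chain_crossings (v i) (rcons (w i j) (v i)) (v k) [:: v l; v n; v k].
rewrite last_rcons => /(_ erefl erefl).
rewrite (eq_has (a2 := mem (v i :: w i j))); last exact: mem_closed.
rewrite has_sym; case: hasPn => [_|[]]; last by move=> z /out.
move=> /(_ isT); rewrite closed_step // chain_crossings_rcons.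
have cut S : chain_crossings S (steps (v k) [:: v l; v n; v k]) =
   chain_crossings S [:: (v k, v l)] (+) chain_crossings S [:: (v l, v n)]
   (+) chain_crossings S [:: (v n, v k)].
  by rewrite -!chain_crossings_rconsr.
rewrite !cut -/(m i j k l) -/(m i j l n) -/(m i j n k) (m_swap kn).
rewrite /chain_crossings !big_seq1 /=.
by rewrite (s_swapl kl) (s_swapl ln) (s_swap2 kn) !addbA.
Qed.

(** The parity system makes the number of crossings between chords even, while [five_points] makes
    it odd. *)
Lemma K5_not_drawn : False.
Proof.
have neq i j k l : independent i j k l -> [/\ v i != v k, v i != v l, v j != v k & v j != v l].
  move=> ind; have ij : (i < j < 5)%N by move: ind; rewrite /independent; lia.
  have [hi hj] := v_in_w ij.
  by have [? ?] := independent_neq ind hi; have [? ?] := independent_neq ind hj.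
have u : uniq [:: v 0; v 1; v 2; v 3; v 4]%N.
  have [n02 n03 n12 n13] := neq 0%N 1%N 2%N 3%N isT.
  have [_ n04 _ n14] := neq 0%N 1%N 3%N 4%N isT.
  have [n01 _ n21 n23] := neq 0%N 2%N 1%N 3%N isT.
  have [_ _ _ n24] := neq 1%N 2%N 3%N 4%N isT.
  have [_ _ _ n34] := neq 1%N 3%N 2%N 4%N isT.
  by rewrite /= !inE !negb_or n01 n02 n03 n04 n12 n13 n14 n23 n24 n34.
have [_] := five_points u.
have := K5_parity_system (fun i j k l => crosses_sym _ _ _ _) walk_walk walk_triangle.
by rewrite !oddD !oddb => /negbTE->.
Qed.

End Drawing.

End Crossings.
End Parity.

(** * Small perturbations and the adjacency graph of a family of discs *)

Module Delaunay.
Import all_boot zify.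
Import Minor Parity.
Set Implicit Arguments.
Unset Strict Implicit.
Unset Printing Implicit Defensive.
Local Open Scope R_scope.

(** Truth for all small enough positive reals. It is stable under finite conjunction, so one
    parameter can meet finitely many conditions. *)
Definition near0 (P : R -> Prop) : Prop :=
  exists d, 0 < d /\ forall s, 0 < s -> s < d -> P s.

Lemma near0_witness P : near0 P -> exists2 s, 0 < s & P s.
Proof. by case=> d [d0 h]; exists (d / 2); [|apply: h]; lra. Qed.

Lemma near0_and P Q : near0 P -> near0 Q -> near0 (fun s => P s /\ Q s).
Proof.
move=> [d [d0 h]] [d' [d'0 h']]; exists (Rmin d d').
split=> [|s s0 sd]; first exact: Rmin_glb_lt.
have := Rmin_l d d'; have := Rmin_r d d'.
by split; [apply: h|apply: h']; lra.
Qed.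

Lemma near0_imp P Q : (forall s, 0 < s -> P s -> Q s) -> near0 P -> near0 Q.
Proof. by move=> h [d [d0 hd]]; exists d; split=> // s s0 sd; apply: h => //; apply: hd. Qed.

Lemma near0_if (A : Prop) P : (A -> near0 P) -> near0 (fun s => A -> P s).
Proof.
case: (classic A) => [a /(_ a)|na _]; first exact: near0_imp.
by exists 1; split; [lra|].
Qed.

Lemma near0_all (T : finType) (P : T -> R -> Prop) :
  (forall x, near0 (P x)) -> near0 (fun s => forall x, P x s).
Proof.
move=> h.
have : near0 (fun s => forall x, x \in enum T -> P x s).
  elim: (enum T) => [|y e IH]; first by exists 1; split; [lra|].
  apply: near0_imp (near0_and (h y) IH) => s _ [hy he] x.
  by rewrite inE => /orP[/eqP->|/he].
by apply: near0_imp => s _ hs x; apply: hs; rewrite mem_enum.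
Qed.

Lemma near0_lt (a b : R) : 0 < b -> near0 (fun s => s * a < b).
Proof.
move=> b0; exists (b / (Rabs a + 1)); have := Rabs_pos a; have := Rle_abs a.
move=> h1 h2; split=> [|s s0 sd]; first by apply: Rdiv_lt_0_compat; lra.
have : s * (Rabs a + 1) < b.
  have -> : b = b / (Rabs a + 1) * (Rabs a + 1) by field; lra.
  by apply: Rmult_lt_compat_r; lra.
by nra.
Qed.

(** Near zero the nonzero coefficient of lowest degree dominates the others. *)
Lemma near0_quadratic (a b c : R) : (a <> 0 \/ b <> 0 \/ c <> 0) ->
  near0 (fun s => a + b * s + c * (s * s) <> 0).
Proof.
move=> h.
have nz x y : x <> 0 -> near0 (fun s => x + y * s <> 0).
  move=> x0; apply: near0_imp (near0_lt (Rabs y) (Rabs_pos_lt _ x0)) => s s0 hs E.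
  have E' : x = - (y * s) by lra.
  by move: hs; rewrite E' Rabs_Ropp Rabs_mult (Rabs_pos_eq s); lra.
have [a0|a0] := Req_dec a 0; last first.
  have H1 := near0_lt (Rabs b + Rabs c) (Rabs_pos_lt _ a0).
  have H2 := near0_lt 1 Rlt_0_1.
  apply: near0_imp (near0_and H1 H2) => s s0 [h1 h2] E.
  have E' : a = - (b * s + c * (s * s)) by lra.
  have : Rabs a <= Rabs b * s + Rabs c * (s * s).
    rewrite {1}E' Rabs_Ropp; apply: Rle_trans (Rabs_triang _ _) _.
    rewrite !Rabs_mult (Rabs_pos_eq s); lra.
  have : Rabs c * (s * s) <= Rabs c * s.
    by apply: Rmult_le_compat_l; [exact: Rabs_pos|nra].
  lra.
have [b0|b0] := Req_dec b 0.
  exists 1; split; first lra.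
  move=> s s0 _; rewrite a0 b0 => E.
  have : c * (s * s) <> 0 by apply: Rmult_integral_contrapositive_currified; nra.
  lra.
apply: near0_imp (nz b c b0) => s s0 hs E; apply: hs.
apply: (Rmult_eq_reg_l s); nra.
Qed.

(** The signed excess of the distance over the radius, negative in the interior of a disc of
    positive radius. *)
Definition reach (d : cdisc) (p : R * R) : R := dist_euc p.1 p.2 (cx d) (cy d) - rad d.

Lemma dist_euc_pos x y x' y' : 0 <= dist_euc x y x' y'.
Proof. exact: sqrt_pos. Qed.

Lemma dist_euc_sqr x y x' y' :
  dist_euc x y x' y' * dist_euc x y x' y' = (x - x') * (x - x') + (y - y') * (y - y').
Proof.
rewrite /dist_euc sqrt_sqrt //.
by apply: Rplus_le_le_0_compat; apply: Rle_0_sqr.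
Qed.

Lemma dist_euc_le x y x' y' r : 0 <= r ->
  (x - x') ^ 2 + (y - y') ^ 2 <= r ^ 2 <-> dist_euc x y x' y' <= r.
Proof.
move=> r0; have := dist_euc_sqr x y x' y'; have := dist_euc_pos x y x' y'.
by move=> h0 h; split; nra.
Qed.

Lemma dist_euc_l1 x y x' y' a b : Rabs (x - x') <= a -> Rabs (y - y') <= b ->
  dist_euc x y x' y' <= a + b.
Proof.
move=> ha hb; have := dist_euc_sqr x y x' y'; have := dist_euc_pos x y x' y'.
have := Rabs_pos (x - x'); have := Rabs_pos (y - y').
have := Rsqr_abs (x - x'); have := Rsqr_abs (y - y'); rewrite /Rsqr => -> -> *.
nra.
Qed.

Lemma dist_euc_scale x y x' y' t : 0 <= t ->
  dist_euc x y (x + t * (x' - x)) (y + t * (y' - y)) = t * dist_euc x y x' y'.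
Proof.
move=> t0; apply: Rsqr_inj; [exact: dist_euc_pos| |].
  by apply: Rmult_le_pos => //; apply: dist_euc_pos.
rewrite Rsqr_mult /Rsqr !dist_euc_sqr; ring.
Qed.

Lemma discs_meet_reach d B : valid_disc d -> valid_disc B ->
  discs_meet d B <-> reach d (cx B, cy B) <= rad B.
Proof.
rewrite /valid_disc /discs_meet /in_disc /reach /= => d0 B0; split.
  move=> [x [y []]]; rewrite !dist_euc_le // => hd hB.
  have := triangle (cx B) (cy B) (cx d) (cy d) x y.
  by rewrite (distance_symm _ _ x y); lra.
set L := dist_euc _ _ _ _ => hL.
have L0 : 0 <= L by apply: dist_euc_pos.
have [z|nz] := Req_dec (rad d + rad B) 0.
  exists (cx d), (cy d); rewrite !dist_euc_le //.
  by rewrite distance_refl (distance_symm (cx d)) -/L; split; lra.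
(* The witness divides the segment of centres in the ratio of the radii. When both radii vanish the
   centres coincide, which was settled first. *)
set t := rad d / (rad d + rad B).
have tt : t * (rad d + rad B) = rad d by rewrite /t; field.
have t0 : 0 <= t by apply: Rmult_le_pos => //; apply: Rlt_le; apply: Rinv_0_lt_compat; lra.
have t1 : t <= 1 by nra.
exists (cx d + t * (cx B - cx d)), (cy d + t * (cy B - cy d)).
rewrite !dist_euc_le //; split.
  rewrite distance_symm dist_euc_scale // distance_symm -/L; nra.
have -> : cx d + t * (cx B - cx d) = cx B + (1 - t) * (cx d - cx B) by ring.
have -> : cy d + t * (cy B - cy d) = cy B + (1 - t) * (cy d - cy B) by ring.
rewrite distance_symm dist_euc_scale -/L; nra.
Qed.

Lemma reach_lipschitz d p q : reach d p <= reach d q + dist_euc p.1 p.2 q.1 q.2.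
Proof. by rewrite /reach; have := triangle p.1 p.2 (cx d) (cy d) q.1 q.2; lra. Qed.

(* Moving from [p] straight towards the centre of [d] decreases [reach d] at unit speed, and no other [reach] decreases faster: the cells are star-shaped. *)
Lemma reach_towards_center d d' p t : 0 <= t <= 1 ->
  let q := (p.1 + t * (cx d - p.1), p.2 + t * (cy d - p.2)) in
  reach d' p - reach d p <= reach d' q - reach d q.
Proof.
move=> [t0 t1] q; rewrite {4}/reach.
have -> : q.1 = cx d + (1 - t) * (p.1 - cx d) by rewrite /q /=; ring.
have -> : q.2 = cy d + (1 - t) * (p.2 - cy d) by rewrite /q /=; ring.
rewrite distance_symm dist_euc_scale; last lra.
have := reach_lipschitz d' p q; rewrite /q /= dist_euc_scale // /reach /=.
rewrite (distance_symm (cx d)); lra.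
Qed.

(** The values at [i] and [j] may differ; they only have to be the two smallest, as in an order-two
    Voronoi cell. *)
Definition delaunay_point (T : finType) (D : T -> cdisc) (P : {set T}) i j p : Prop :=
  forall k, k \in P -> k != i -> k != j ->
    reach (D i) p < reach (D k) p /\ reach (D j) p < reach (D k) p.

Definition delaunay (T : finType) (D : T -> cdisc) (P : {set T}) : rel T :=
  fun i j => (i != j) &&
    if excluded_middle_informative (exists p, delaunay_point D P i j p)
    then true else false.

Lemma delaunayP (T : finType) (D : T -> cdisc) (P : {set T}) i j :
  reflect (i != j /\ exists p, delaunay_point D P i j p) (delaunay D P i j).
Proof.
rewrite /delaunay; case: excluded_middle_informative => h; rewrite ?andbT ?andbF.
  by apply: (iffP idP) => [|[]].
by constructor => -[_ /h].
Qed.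

Lemma delaunay_sym (T : finType) (D : T -> cdisc) (P : {set T}) : symmetric (delaunay D P).
Proof.
move=> i j; apply/delaunayP/delaunayP => -[ij [p hp]];
  split; rewrite 1?eq_sym //; exists p => k kP ki kj;
  by have [] := hp k kP kj ki.
Qed.

Lemma delaunay_irr (T : finType) (D : T -> cdisc) (P : {set T}) : irreflexive (delaunay D P).
Proof. by move=> i; rewrite /delaunay eqxx. Qed.

Lemma exists_argmin (T : eqType) (g : T -> R) (s : seq T) : s != [::] ->
  exists2 x, x \in s & forall y, y \in s -> g x <= g y.
Proof.
elim: s => // x s IH _; have [->|/IH[z zs hz]] := eqVneq s [::].
  by exists x; rewrite ?inE // => y; rewrite inE => /eqP->; lra.
have [xz|zx] := Rle_lt_dec (g x) (g z).
  exists x; rewrite ?inE ?eqxx // => y; rewrite inE => /orP[/eqP->|/hz]; lra.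
exists z; rewrite ?inE ?zs ?orbT // => y; rewrite inE => /orP[/eqP->|/hz]; lra.
Qed.

(* Two distinct reaches agree on a hyperbola (or a line), which a generic line meets in at most two points: squaring twice leaves a quadratic equation whose leading coefficient is the one made nonzero here. *)
Lemma generic_slope d e : d <> e ->
  near0 (fun s => (cx d - cx e + s * (cy d - cy e)) ^ 2
                  - (rad d - rad e) ^ 2 * (1 + s * s) <> 0).
Proof.
case: d e => [x y r] [x' y' r'] /= ne.
apply: near0_imp (@near0_quadratic ((x - x') ^ 2 - (r - r') ^ 2)
  (2 * (x - x') * (y - y')) ((y - y') ^ 2 - (r - r') ^ 2) _); first by move=> s _; nra.
apply: NNPP => h; apply: ne.
have [h1 [h2 h3]] : (x - x') ^ 2 - (r - r') ^ 2 = 0 /\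
    2 * (x - x') * (y - y') = 0 /\ (y - y') ^ 2 - (r - r') ^ 2 = 0.
  by split; [|split]; apply: NNPP => n; apply: h; tauto.
have sq0 z : z ^ 2 = 0 -> z = 0 by move=> z2; apply: Rsqr_0_uniq; rewrite /Rsqr; lra.
have hr : r - r' = 0.
  apply: sq0; have [X0|Y0] : x - x' = 0 \/ y - y' = 0.
  - by apply: Rmult_integral; lra.
  - by move: h1; rewrite X0; lra.
  - by move: h3; rewrite Y0; lra.
have hx : x - x' = 0 by apply: sq0; move: h1; rewrite hr; lra.
have hy : y - y' = 0 by apply: sq0; move: h3; rewrite hr; lra.
by congr mkCDisc; lra.
Qed.

Definition shift (p : R * R) (s t : R) : R * R := (p.1 + t, p.2 + t * s).

Lemma generic_shift d e p s :
  (cx d - cx e + s * (cy d - cy e)) ^ 2 - (rad d - rad e) ^ 2 * (1 + s * s) <> 0 ->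
  near0 (fun t => reach d (shift p s t) <> reach e (shift p s t)).
Proof.
set A := _ - _ => A0.
pose u := p.1 - cx d; pose u' := p.2 - cy d.
pose v := p.1 - cx e; pose v' := p.2 - cy e.
pose c := rad d - rad e.
(* With [X] and [Y] the distances to the two centres, [X ^ 2 - Y ^ 2 - c ^ 2] is the affine function
   [l0 + l1 * t], and it equals [2 * c * Y] when the reaches agree. *)
pose l0 := u * u + u' * u' - v * v - v' * v' - c * c.
pose l1 := 2 * (u + s * u' - v - s * v').
apply: near0_imp (@near0_quadratic (l0 ^ 2 - 4 * c ^ 2 * (v * v + v' * v'))
  (2 * l0 * l1 - 4 * c ^ 2 * (2 * (v + s * v'))) (4 * A) _); last by right; right; lra.
move=> t _ hq; rewrite /reach => E; apply: hq.
have := dist_euc_sqr (shift p s t).1 (shift p s t).2 (cx e) (cy e).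
have := dist_euc_sqr (shift p s t).1 (shift p s t).2 (cx d) (cy d).
move: E; set X := dist_euc _ _ (cx d) _; set Y := dist_euc _ _ (cx e) _ => E.
have -> : X = Y + c by rewrite /c; lra.
rewrite /= => hX hY.
have hl : l0 + l1 * t = 2 * c * Y.
  by rewrite /l0 /l1 /u /u' /v /v'; nra.
have hY' : Y * Y = v * v + v' * v' + 2 * (v + s * v') * t + (1 + s * s) * (t * t).
  by rewrite hY /v /v'; ring.
have hA : 4 * A = l1 ^ 2 - 4 * c ^ 2 * (1 + s * s).
  by rewrite /A /l1 /c /u /u' /v /v'; ring.
have : (l0 + l1 * t) ^ 2 - 4 * c ^ 2 * (Y * Y) = 0 by rewrite hl; ring.
by rewrite hY' hA => <-; ring.
Qed.

Lemma reach_shift d p s t : 0 < t ->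
  reach d p - t * (1 + Rabs s) <= reach d (shift p s t) <= reach d p + t * (1 + Rabs s).
Proof.
move=> t0; have := reach_lipschitz d p (shift p s t).
have := reach_lipschitz d (shift p s t) p.
rewrite (distance_symm (shift p s t).1).
have : dist_euc p.1 p.2 (shift p s t).1 (shift p s t).2 <= t + t * Rabs s.
  apply: dist_euc_l1 => /=.
    by rewrite (_ : _ - _ = - t) ?Rabs_Ropp ?Rabs_pos_eq; lra.
  rewrite (_ : _ - _ = - (t * s)) ?Rabs_Ropp ?Rabs_mult ?(Rabs_pos_eq t); lra.
by move=> h1 h2 h3; split; lra.
Qed.

(** A small generic shift of [p] breaks all ties, while discs within [r] still precede those beyond
    it. The two smallest values at the shifted point give the edge. *)
Lemma sublevel_has_edge (T : finType) (D : T -> cdisc) (P : {set T}) p r a b :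
  {in P &, injective D} -> a \in P -> b \in P -> a != b ->
  reach (D a) p <= r -> reach (D b) p <= r ->
  exists i j, [/\ i \in P, j \in P, reach (D i) p <= r, reach (D j) p <= r
                 & delaunay D P i j].
Proof.
move=> injD aP bP ab ha hb.
have [s _ hs] : exists2 s, 0 < s & forall i j, [/\ i \in P, j \in P & i != j] ->
    (cx (D i) - cx (D j) + s * (cy (D i) - cy (D j))) ^ 2
      - (rad (D i) - rad (D j)) ^ 2 * (1 + s * s) <> 0.
  apply: near0_witness; apply: near0_all => i; apply: near0_all => j.
  apply: near0_if => -[iP jP ij]; apply: generic_slope => E.
  by move/eqP: ij; apply; apply: injD.
have [t _ [ht1 ht2]] : exists2 t, 0 < t &
    (forall i j, [/\ i \in P, j \in P & i != j] ->
      reach (D i) (shift p s t) <> reach (D j) (shift p s t)) /\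
    (forall i j, reach (D i) p <= r /\ r < reach (D j) p ->
      reach (D i) (shift p s t) < reach (D j) (shift p s t)).
  apply: near0_witness; apply: near0_and; apply: near0_all => i; apply: near0_all => j; apply: near0_if.
    by move=> h; apply: generic_shift; apply: hs.
  move=> [hi hj]; have gap : 0 < reach (D j) p - reach (D i) p by lra.
  apply: near0_imp (near0_lt (2 * (1 + Rabs s)) gap) => t t0 h.
  have := reach_shift (D i) p s t0; have := reach_shift (D j) p s t0.
  by move=> [? ?] [? ?]; lra.
have pick_min (Q : {set T}) : Q \subset P -> (exists2 i, i \in Q & reach (D i) p <= r) ->
    exists i, [/\ i \in Q, reach (D i) p <= r & forall k, k \in Q -> k != i ->
      reach (D i) (shift p s t) < reach (D k) (shift p s t)].
  move=> QP [i0 i0Q hi0]; have sQ := subsetP QP.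
  have e0 : enum Q != [::] by apply/eqP => E; move: i0Q; rewrite -mem_enum E.
  have [i + hi] := exists_argmin (fun i => reach (D i) (shift p s t)) e0.
  rewrite mem_enum => iQ; exists i.
  have lt_i k : k \in Q -> k != i -> reach (D i) (shift p s t) < reach (D k) (shift p s t).
    move=> kQ ki; have := ht1 k i (And3 (sQ _ kQ) (sQ _ iQ) ki).
    by have := hi k; rewrite mem_enum => /(_ kQ); lra.
  split=> //; have [<-//|ii0] := eqVneq i0 i.
  apply: Rnot_lt_le => lt_r; have := lt_i _ i0Q ii0; have := ht2 i0 i (conj hi0 lt_r); lra.
have [i [iP hi lt_i]] := pick_min P (subxx _) (ex_intro2 _ _ a aP ha).
(* One of [a] and [b] differs from the minimiser [i], so a second disc within [r] remains. *)
have [c cP hc] : exists2 c, c \in P :\ i & reach (D c) p <= r.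
  have [E|ai] := eqVneq a i; last by exists a; rewrite ?inE ?ai.
  by exists b; rewrite ?inE -?E 1?eq_sym ?ab.
have [j [/setD1P[ji jP] hj lt_j]] := pick_min _ (subD1set P i) (ex_intro2 _ _ c cP hc).
exists i, j; split=> //; apply/delaunayP; split; first by rewrite eq_sym.
exists (shift p s t) => k kP ki kj; split; first exact: lt_i.
by apply: lt_j; rewrite // !inE ki.
Qed.



(** * Drawing a complete minor by polygonal paths *)

Lemma crossing_point (X : eqType) (pt : X -> R * R) a b c d : crosses pt a b c d ->
  exists t u, [/\ 0 <= t <= 1, 0 <= u <= 1,
    (pt a).1 + t * ((pt b).1 - (pt a).1) = (pt c).1 + u * ((pt d).1 - (pt c).1)
  & (pt a).2 + t * ((pt b).2 - (pt a).2) = (pt c).2 + u * ((pt d).2 - (pt c).2)].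
Proof.
rewrite /crosses /ccw.
set A := det (pt a) _ (pt c); set B := det (pt a) _ (pt d).
set E := det (pt c) _ (pt a); set F := det (pt c) _ (pt b) => /andP[hAB hEF].
have AB : A - B = F - E by rewrite /A /B /E /F /det; ring.
have ratio x y : pos x != pos y -> x - y <> 0 /\ 0 <= x / (x - y) <= 1.
  case: posP => hx; case: posP => hy //= _.
  - split; first lra; split; first by apply: Rmult_le_pos; [lra|apply/Rlt_le/Rinv_0_lt_compat; lra].
    apply: (Rmult_le_reg_r (x - y)); first lra.
    by rewrite /Rdiv Rmult_assoc Rinv_l; lra.
  - have -> : x / (x - y) = - x / (y - x) by field; lra.
    split; first lra; split; first by apply: Rmult_le_pos; [lra|apply/Rlt_le/Rinv_0_lt_compat; lra].
    apply: (Rmult_le_reg_r (y - x)); first lra.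
    by rewrite /Rdiv Rmult_assoc Rinv_l; lra.
have [nAB uAB] := ratio _ _ hAB; have [nEF tEF] := ratio _ _ hEF.
(* The parameters of the intersection by Cramer's rule; the differing signs put them into the unit
   interval. *)
set t := E / (E - F); set u := A / (A - B).
have ht : t * (E - F) = E by rewrite /t; field.
have hu : u * (E - F) = - A.
  by rewrite (_ : E - F = - (A - B)); [rewrite /u; field | lra].
have combine p q r s : p * (E - F) + E * q = r * (E - F) - A * s -> p + t * q = r + u * s.
  move=> h; apply: (Rmult_eq_reg_r (E - F)) => //.
  transitivity (p * (E - F) + t * (E - F) * q); first ring.
  transitivity (r * (E - F) + u * (E - F) * s); last ring.
  by rewrite ht hu h; ring.
by exists t, u; split=> //; apply: combine; rewrite /A /E /F /det; ring.
Qed.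

Lemma clique_model_nth (T : finType) (e : rel T) (s : seq {set T}) i j :
  clique_model e s -> (i < j < size s)%N ->
  [/\ conn e (nth set0 s i), conn e (nth set0 s j),
      [disjoint nth set0 s i & nth set0 s j] & touch e (nth set0 s i) (nth set0 s j)].
Proof.
elim: s i j => [|X s IH] i j; first by move=> _ /andP[].
have connP (s' : seq {set T}) k : clique_model e s' -> (k < size s')%N -> conn e (nth set0 s' k).
  by elim: s' k => // Y s' IH' [|k] [cY _ cs'] //=; apply: IH'.
move=> cXs ijs; have [cX hX cs] := cXs.
case: i j ijs => [|i] [|j] //= ijs; last exact: IH.
have [dXY tXY] := hX _ (mem_nth set0 ijs).
by split=> //; apply: connP.
Qed.

Section Drawing.

Variables (T : finType) (D : T -> cdisc) (P : {set T}).

Notation e := (delaunay D P).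
(** The left summand stands for centres of discs, the right one for the points chosen on ordered
    edges. *)
Notation node := (T + T * T)%type.

Definition edge_point i j : R * R :=
  epsilon (inhabits (0, 0)) (delaunay_point D P i j).

Lemma edge_pointP i j : e i j -> delaunay_point D P i j (edge_point i j).
Proof. by move=> /delaunayP[_ h]; apply: epsilon_spec. Qed.

(** Finitely many strict inequalities have a common slack, against which the displacement of the
    nodes is measured. *)
Lemma edge_margin : exists2 m, 0 < m & forall i j k, [/\ e i j, k \in P, k != i & k != j] ->
  reach (D i) (edge_point i j) + m <= reach (D k) (edge_point i j) /\
  reach (D j) (edge_point i j) + m <= reach (D k) (edge_point i j).
Proof.
apply: near0_witness; do 3 apply: near0_all => ?; apply: near0_if => -[eij kP ki kj].
have [h1 h2] := edge_pointP eij kP ki kj.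
have g1 := Rlt_Rminus _ _ h1; have g2 := Rlt_Rminus _ _ h2.
by apply: near0_imp (near0_and (near0_lt 1 g1) (near0_lt 1 g2)) => m m0 [? ?]; lra.
Qed.

Definition node_base (x : node) : R * R :=
  match x with
  | inl i => (cx (D i), cy (D i))
  | inr (i, j) => edge_point i j
  end.

Definition node_weight (x : node) : R := INR (enum_rank x).

(* Points on a parabola are in general position, so all but finitely many multiples of this displacement put the drawing in general position. *)
Definition node_at (s : R) (x : node) : R * R :=
  ((node_base x).1 + s * node_weight x,
   (node_base x).2 + s * (node_weight x * node_weight x)).

Lemma node_at_generic : near0 (fun s => forall a b c, uniq [:: a; b; c] ->
  det (node_at s a) (node_at s b) (node_at s c) <> 0).
Proof.
apply: near0_all => a; apply: near0_all => b; apply: near0_all => c; apply: near0_if.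
rewrite /= !inE negb_or andbT => /andP[/andP[ab ac] bc].
have neq x y : x != y -> node_weight y - node_weight x <> 0.
  move=> /eqP xy E; apply: xy; apply/enum_rank_inj/val_inj/INR_eq.
  by move: E; rewrite /node_weight /=; lra.
rewrite /det /node_at /=.
set A := node_base a; set B := node_base b; set C := node_base c.
set x := node_weight a; set y := node_weight b; set z := node_weight c.
(* The determinant is quadratic in [s], and its leading coefficient is a Vandermonde product of
   distinct weights. *)
apply: near0_imp (@near0_quadratic (det A B C)
  ((B.1 - A.1) * (z * z - x * x) + (y - x) * (C.2 - A.2)
   - (B.2 - A.2) * (z - x) - (y * y - x * x) * (C.1 - A.1))
  ((y - x) * (z - x) * (z - y)) _) => [s _ h E|].
  by apply: h; rewrite /det -[RHS]E; ring.
right; right; apply: Rmult_integral_contrapositive_currified; last exact: neq.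
by apply: Rmult_integral_contrapositive_currified; apply: neq.
Qed.

Lemma node_weight_bound : exists2 M, 0 <= M &
  forall x, 0 <= node_weight x <= M /\ 0 <= node_weight x * node_weight x <= M.
Proof.
exists (INR #|{: node}| * INR #|{: node}|); first by have := pos_INR #|{: node}|; nra.
move=> x; have := pos_INR (enum_rank x); rewrite -/(node_weight x) => x0.
have : node_weight x + 1 <= INR #|{: node}|.
  by rewrite -S_INR; apply: le_INR; apply/leP; exact: ltn_ord.
by split; nra.
Qed.

Definition edge_half i j (s : node * node) : Prop :=
  s = (inl i, inr (i, j)) \/ s = (inr (i, j), inl j).

(** On the undisplaced half edge the margin [m] persists by [reach_towards_center]. Displacement
    moves the point by at most [2 s M] and hence changes each of the two reaches by at most that
    much, together [4 s M]. *)
Lemma edge_half_reach m M s i j st t q :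
  (forall k, [/\ e i j, k \in P, k != i & k != j] ->
     reach (D i) (edge_point i j) + m <= reach (D k) (edge_point i j) /\
     reach (D j) (edge_point i j) + m <= reach (D k) (edge_point i j)) ->
  (forall x, 0 <= node_weight x <= M /\ 0 <= node_weight x * node_weight x <= M) ->
  0 < s -> e i j -> edge_half i j st -> 0 <= t <= 1 ->
  q = ((node_at s st.1).1 + t * ((node_at s st.2).1 - (node_at s st.1).1),
       (node_at s st.1).2 + t * ((node_at s st.2).2 - (node_at s st.1).2)) ->
  exists2 c, c = i \/ c = j & forall k, k \in P -> k != i -> k != j ->
    reach (D c) q + m <= reach (D k) q + s * (4 * M).
Proof.
move=> hm hM s0 eij hst ht hq.
have {hst hq} [c [u [hc hu hq]]] : exists c u, [/\ c = i \/ c = j, 0 <= u <= 1 &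
   q = ((node_at s (inr (i, j))).1 + u * ((node_at s (inl c)).1 - (node_at s (inr (i, j))).1),
        (node_at s (inr (i, j))).2 + u * ((node_at s (inl c)).2 - (node_at s (inr (i, j))).2))].
  case: hst hq => -> /= ->.
    by exists i, (1 - t); split; [left|lra|congr pair; ring].
  by exists j, t; split; [right| |].
exists c => // k kP ki kj.
pose p := edge_point i j.
pose q0 := (p.1 + u * (cx (D c) - p.1), p.2 + u * (cy (D c) - p.2)).
have close : dist_euc q.1 q.2 q0.1 q0.2 <= s * M + s * M.
  have [h1 h2] := hM (inr (i, j)); have [h3 h4] := hM (inl c).
  have mix x y : 0 <= x <= M -> 0 <= y <= M -> Rabs (s * (x + u * (y - x))) <= s * M.
    move=> hx hy; have h : 0 <= x + u * (y - x) <= M by nra.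
    by rewrite Rabs_pos_eq; nra.
  apply: dist_euc_l1; rewrite hq /q0 /node_at /= -/p.
    have := mix _ _ h1 h3; congr (Rabs _ <= _); ring.
  have := mix _ _ h2 h4; congr (Rabs _ <= _); ring.
have l1 := reach_lipschitz (D c) q q0.
have l2 := reach_lipschitz (D k) q0 q; rewrite distance_symm in l2.
have star := reach_towards_center (D c) (D k) p hu; rewrite -/q0 in star.
have [hi hj] := hm k (And4 eij kP ki kj).
have gap : reach (D c) p + m <= reach (D k) p by case: hc => ->.
move: l1 l2 star gap close; rewrite /=; lra.
Qed.

Fixpoint expand (a : T) (q : seq T) : seq node :=
  if q is b :: q' then inr (a, b) :: inl b :: expand b q' else [::].

Lemma last_expand a q : last (inl a) (expand a q) = inl (last a q).
Proof. by elim: q a => //= b q IH a. Qed.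

Definition in_cluster (U : {set T}) (x : node) : bool :=
  match x with inl i => i \in U | inr (i, j) => (i \in U) && (j \in U) end.

Lemma expand_cluster (r : rel T) (U : {set T}) a q :
  a \in U -> path (inside r U) a q -> all (in_cluster U) (inl a :: expand a q).
Proof.
rewrite /= => aU; rewrite aU /=.
elim: q a aU => //= b q IH a aU /andP[/and3P[_ bU _] hq].
by rewrite aU bU /= IH.
Qed.

Lemma steps_expand (r : rel T) a q st : path r a q ->
  st \in steps (inl a) (expand a q) -> exists i j, r i j /\ edge_half i j st.
Proof.
elim: q a => //= b q IH a /andP[rab hq].
rewrite !steps_cons !inE => /or3P[/eqP->|/eqP->|/(IH _ hq)//]; exists a, b; split=> //.
  by left.
by right.
Qed.

(** A root in each branch set is joined to the others by walks inside the union of two branch sets.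
    For independent pairs these unions are disjoint, and the walks drawn through edge points meet
    the conditions of [K5_not_drawn]. *)
Lemma delaunay_no_K5 (s : seq {set T}) : size s = 5%N ->
  (forall X, X \in s -> X != set0 /\ X \subset P) -> ~ clique_model e s.
Proof.
move=> s5 hs cs.
pose X i := nth set0 s i.
have XP i : (i < 5)%N -> X i != set0 /\ X i \subset P.
  by move=> i5; apply: hs; apply: mem_nth; rewrite s5.
have hX i j : (i < j < 5)%N -> [/\ conn e (X i), conn e (X j),
    [disjoint X i & X j] & touch e (X i) (X j)].
  by move=> ij; apply: clique_model_nth => //; rewrite s5.
have disX i j : (i < 5)%N -> (j < 5)%N -> i != j -> [disjoint X i & X j].
  move=> i5 j5; rewrite neq_ltn => /orP[ij|ji].
    by have [] := hX i j; rewrite ?ij.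
  by rewrite disjoint_sym; have [] := hX j i; rewrite ?ji.
have [x0 _] : exists x0, x0 \in X 0%N by apply/set0Pn; case: (XP 0%N).
pose root i := epsilon (inhabits x0) (fun x => x \in X i).
have rootP i : (i < 5)%N -> root i \in X i.
  by move=> /XP[/set0Pn h _]; apply: (epsilon_spec (inhabits x0) (fun x => x \in X i)).
pose walk i j := epsilon (inhabits [::]) (fun q =>
  path (inside e (X i :|: X j)) (root i) q /\ last (root i) q = root j).
have walkP i j : (i < j < 5)%N ->
    path (inside e (X i :|: X j)) (root i) (walk i j) /\ last (root i) (walk i j) = root j.
  move=> ij; have [ci cj _ tij] := hX i j ij.
  apply: (epsilon_spec (inhabits [::]) (fun q =>
    path (inside e (X i :|: X j)) (root i) q /\ last (root i) q = root j)).
  have /connectP[q hq ->] : connect (inside e (X i :|: X j)) (root i) (root j).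
    apply: (conn_setU (@delaunay_sym _ D P) ci cj tij); rewrite inE rootP ?orbT //; lia.
  by exists q.
pose v i : node := inl (root i).
pose w i j := expand (root i) (walk i j).
have [m m0 hm] := edge_margin.
have [M M0 hM] := node_weight_bound.
(* General position, together with an error [4 M eps] below the margin [m]. *)
have [eps e0 [gen small]] := near0_witness (near0_and node_at_generic (near0_lt (4 * M) m0)).
have ij5 i j k l : independent i j k l -> (i < j < 5)%N /\ (k < l < 5)%N.
  by rewrite /independent; lia.
have disU i j k l : independent i j k l -> [disjoint X i :|: X j & X k :|: X l].
  move=> ind; have [ij kl] := ij5 _ _ _ _ ind.
  rewrite disjointsUl ![[disjoint _ & X k :|: X l]]disjoint_sym !disjointsUl.
  by rewrite !disX //; move: ind; rewrite /independent; lia.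
have inU i j : (i < j < 5)%N -> all (in_cluster (X i :|: X j)) (v i :: w i j).
  move=> ij; have [hq _] := walkP i j ij.
  by apply: expand_cluster hq; rewrite inE rootP //; lia.
apply: (@K5_not_drawn _ (node_at eps) gen v w).
- by move=> i j ij; rewrite last_expand (walkP i j ij).2.
- move=> i j k l ind; have [ij kl] := ij5 _ _ _ _ ind.
  apply/hasPn => z /(allP (inU k l kl)) hz; apply/negP => /(allP (inU i j ij)) hz'.
  have dis := disjointFr (disU _ _ _ _ ind).
  case: z hz hz' => [z hz hz'|[z z'] /andP[hz _] /andP[hz' _]];
    by have := dis _ hz'; move: hz => /= ->.
- move=> i j k l ind; have [ij kl] := ij5 _ _ _ _ ind.
  apply: big1_seq => st /= hst; apply: big1_seq => st' /= hst'.
  have [a [b [/and3P[aU bU eab] hab]]] := steps_expand (walkP i j ij).1 hst.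
  have [c [d [/and3P[cU dU ecd] hcd]]] := steps_expand (walkP k l kl).1 hst'.
  apply/negP => /crossing_point[t [u [ht hu E1 E2]]].
  have sUP i' j' : (i' < j' < 5)%N -> X i' :|: X j' \subset P.
    by move=> h; rewrite subUset (XP i' _).2 ?(XP j' _).2 //; lia.
  have dis := disjointFr (disU _ _ _ _ ind).
  have ne x y : x \in X i :|: X j -> y \in X k :|: X l -> x != y.
    by move=> hx hy; apply: contraTneq hy => <-; rewrite (dis _ hx).
  (* At a crossing, [f] would beat [g] by [m] up to the error, and [g] would beat [f] likewise;
     adding yields [m <= 4 M eps]. *)
  have [f hf Hf] := edge_half_reach (fun x => hm a b x) hM e0 eab hab ht erefl.
  have [g hg Hg] := edge_half_reach (fun x => hm c d x) hM e0 ecd hcd hu erefl.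
  have fU : f \in X i :|: X j by case: hf => ->.
  have gU : g \in X k :|: X l by case: hg => ->.
  have gP := subsetP (sUP k l kl) _ gU; have fP := subsetP (sUP i j ij) _ fU.
  have := Hf g gP; rewrite ![g == _]eq_sym !ne // => /(_ isT isT).
  have := Hg f fP; rewrite !ne // => /(_ isT isT).
  rewrite E1 E2; lra.
Qed.

End Drawing.

End Delaunay.

(** * The upper bound for conflict-free colourings *)

Module Coloring.
Import all_boot zify.
Import Minor Delaunay.
Set Implicit Arguments.
Unset Strict Implicit.
Unset Printing Implicit Defensive.
Local Open Scope R_scope.

Lemma ln_le x y : 0 < x -> x <= y -> ln x <= ln y.
Proof.
move=> x0 /Rle_lt_or_eq_dec[xy|->]; last exact: Rle_refl.
exact/Rlt_le/ln_increasing.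
Qed.

Section Upper.

Variables (T : finType) (D : T -> cdisc).
Hypothesis D_inj : injective D.

Definition conflict_free (P : {set T}) (col : T -> nat) : Prop :=
  forall p r, (exists2 i, i \in P & reach (D i) p <= r) ->
  exists i, [/\ i \in P, reach (D i) p <= r
    & forall j, j \in P -> reach (D j) p <= r -> j != i -> col j <> col i].

Lemma ln_16_15_pos : 0 < ln (16 / 15).
Proof. by rewrite -ln_1; apply: ln_increasing; lra. Qed.

Lemma INR_card_pos (P : {set T}) : P != set0 -> 0 < INR #|P|.
Proof. by rewrite -card_gt0 => h; apply: lt_0_INR; apply/ltP. Qed.

(** Each round spends one colour on an independent set of at least a sixteenth of the discs, so
    while discs remain the logarithm of their number drops by at least [ln (16 / 15)]. *)
Lemma conflict_free_coloring (P : {set T}) : exists k col,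
  [/\ forall i, i \in P -> (col i < k)%N,
      P = set0 -> k = 0%N,
      P != set0 -> INR k <= 1 + ln (INR #|P|) / ln (16 / 15)
    & conflict_free P col].
Proof.
have [n] := ubnP #|P|; elim: n P => // n IH P ltP.
have [->|P0] := eqVneq P set0.
  exists 0%N, (fun=> 0%N); split=> // [i|p r [i]]; by rewrite inE.
have [I [sIP indI cI]] : exists I : {set T}, [/\ I \subset P,
    {in I &, forall x y, ~~ delaunay D P x y} & (#|P| <= 16 * #|I|)%N].
  apply: no_K5_independent; first exact: delaunay_sym.
    exact: delaunay_irr.
  exact: delaunay_no_K5.
have cP : (0 < #|P|)%N by rewrite card_gt0.
have cPI : (#|P :\: I| + #|I| = #|P|)%N.
  by rewrite cardsD (setIidPr sIP) subnK // subset_leq_card.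
have [|k [col [colk k0 kln cf]]] := IH (P :\: I); first by lia.
exists k.+1, (fun i => if i \in I then k else col i); split.
- move=> i iP; case: ifP => // /negbT iI; apply: ltnW; apply: colk.
  by rewrite inE iI.
- by move=> E; rewrite E eqxx in P0.
- move=> _; have lpos := ln_16_15_pos.
  have [E|PI0] := eqVneq (P :\: I) set0.
    rewrite (k0 E) /=; have : 0 <= ln (INR #|P|) / ln (16 / 15); last lra.
    apply: Rmult_le_pos; last by apply: Rlt_le; apply: Rinv_0_lt_compat.
    have h1 : 1 <= INR #|P| by rewrite -[1]/(INR 1); apply: le_INR; apply/leP.
    by rewrite -ln_1; apply: ln_le; lra.
  rewrite S_INR; have hk := kln PI0.
  have hc : INR #|P :\: I| * (16 / 15) <= INR #|P|.
    have : (16 * #|P :\: I| <= 15 * #|P|)%N by lia.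
    move/leP/le_INR; rewrite !mult_INR -[INR 16]/(INR (8 * 2)) /=; lra.
  have hl : ln (INR #|P :\: I|) + ln (16 / 15) <= ln (INR #|P|).
    have h0 := INR_card_pos PI0.
    by rewrite -ln_mult; [apply: ln_le => //; nra|lra|lra].
  have : (ln (INR #|P :\: I|) + ln (16 / 15)) / ln (16 / 15) <= ln (INR #|P|) / ln (16 / 15).
    by apply: Rmult_le_compat_r => //; apply: Rlt_le; apply: Rinv_0_lt_compat.
  rewrite Rdiv_plus_distr [ln (16 / 15) / _]Rdiv_diag; lra.
- move=> p r [a aP ha].
  (* If some disc outside [I] is met, the earlier colouring provides the unique one, whose colour is
     not [k]. Otherwise all discs met lie in [I], and two of them would force an edge within [I]. *)
  have [[b bPI hb]|none] := classic (exists2 b, b \in P :\: I & reach (D b) p <= r).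
    have [i [iPI hi ui]] := cf p r (ex_intro2 _ _ b bPI hb).
    move: (iPI); rewrite inE => /andP[iI iP]; exists i; split=> // j jP hj ji.
    rewrite (negbTE iI); case: ifP => [_ E|/negbT jI].
      by have := colk i iPI; rewrite -E ltnn.
    by apply: ui => //; rewrite inE jI.
  have inI b : b \in P -> reach (D b) p <= r -> b \in I.
    move=> bP hb; apply: contraT => bI; case: none; exists b => //.
    by rewrite inE bI.
  exists a; split=> // j jP hj ja; exfalso.
  have injP : {in P &, injective D} by move=> x y _ _; apply: D_inj.
  have [i [i' [iP i'P hi hi' eii']]] := sublevel_has_edge injP jP aP ja hj ha.
  by have := indI i i' (inI i iP hi) (inI i' i'P hi'); rewrite eii'.
Qed.

End Upper.

Lemma cf_coloring_log n F : (2 <= n)%coq_nat -> disc_family n F ->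
  exists (k : nat) (col : nat -> nat), coloring n k col /\
    INR k <= (/ ln 2 + / ln (16 / 15)) * ln (INR n) /\ cf_discs n F col.
Proof.
move=> n2 [validF injF].
have D_inj : injective (fun i : 'I_n => F i).
  by move=> i j /injF E; apply: val_inj; apply: E; apply/ltP.
have [k [col [colk _ kln cf]]] := conflict_free_coloring D_inj [set: 'I_n].
exists k, (fun i => if insub i is Some j then col j else 0%N); split; [|split].
- by move=> i /ltP ltin; rewrite insubT; apply/ltP; apply: colk.
- have ln2 := ln_lt_2.
  have hn : ln 2 <= ln (INR n).
    by apply: ln_le; [lra|rewrite -[2]/(INR 2); apply: le_INR].
  have : INR k <= 1 + ln (INR n) / ln (16 / 15).
    have := kln; rewrite cardsT card_ord; apply.
    by rewrite -card_gt0 cardsT card_ord; lia.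
  (* As [n >= 2], the additive 1 is absorbed into the constant. *)
  have : 1 <= / ln 2 * ln (INR n).
    by apply: (Rmult_le_reg_l (ln 2)); first lra; rewrite -Rmult_assoc Rinv_r; lra.
  rewrite /Rdiv; lra.
- move=> B vB [i [ltin mi]].
  have meetE j : (j < n)%coq_nat -> discs_meet (F j) B <-> reach (F j) (cx B, cy B) <= rad B.
    by move=> ltjn; apply: discs_meet_reach => //; apply: validF.
  have [|a [_ ha ua]] := cf (cx B, cy B) (rad B).
    by move/ltP: (ltin) => h; exists (Ordinal h); rewrite ?inE //; apply/(meetE i).
  have lta : (a < n)%coq_nat by apply/ltP.
  exists a; split=> //; split; first exact/meetE.
  move=> j ltjn /(meetE j ltjn) hj ja; have h := ltjn; move/ltP: h => h.
  rewrite valK insubT; apply: ua => //.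
  by apply/eqP => E; apply: ja; rewrite -E.
Qed.

(** * The lower bound from points on a line *)

Definition interval_cf (a b : nat) (col : nat -> nat) : Prop :=
  forall c d, (a <= c -> c <= d -> d < b ->
  exists2 i, c <= i <= d & forall j, c <= j <= d -> j != i -> col j != col i)%N.

(** The uniquely coloured [i] of the whole range splits it into two parts that avoid its colour. If
    each part is shorter than [2 ^ l], the whole is shorter than [2 ^ l.+1]. *)
Lemma interval_cf_colors (L : seq nat) a b col :
  (forall i, a <= i < b -> col i \in L)%N -> interval_cf a b col ->
  (b - a < 2 ^ size L)%N.
Proof.
have [n] := ubnP (size L); elim: n L a b => // n IH L a b ltL inL cf.
have [ab|ba] := ltnP a b; last by rewrite (_ : b - a = 0)%N ?expn_gt0 //; lia.
have [|||i /andP[ai ib] ui] := cf a b.-1; try lia.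
pose L' := [seq x <- L | x != col i].
have iL : col i \in L by apply: inL; lia.
have sL' : (size L' < size L)%N.
  by rewrite size_filter -(count_predC (pred1 (col i)) L) -[X in (X < _)%N]add0n ltn_add2r
    -has_count has_pred1.
have sub c d : (a <= c)%N -> (d <= b)%N -> (forall j, c <= j < d -> j != i)%N ->
    (d - c < 2 ^ size L')%N.
  move=> ac db ne; apply: IH; first exact: leq_trans sL' _.
  - move=> j cjd; rewrite mem_filter inL ?andbT; last lia.
    by apply: ui; [lia|apply: ne].
  - by move=> c' d' *; apply: cf; lia.
have h1 : (i - a < 2 ^ size L')%N by apply: sub; lia.
have h2 : (b - i.+1 < 2 ^ size L')%N by apply: sub; lia.
have h3 : (2 ^ (size L').+1 <= 2 ^ size L)%N by rewrite leq_exp2l.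
rewrite expnS in h3; lia.
Qed.

Definition collinear_points (i : nat) : cdisc := mkCDisc (INR i) 0 0.

Lemma collinear_points_family n : disc_family n collinear_points.
Proof.
split=> [i _|i j _ _ [/INR_eq //]]; rewrite /valid_disc /=; lra.
Qed.

(** The probing disc has the segment from [INR c] to [INR d] on the axis as a diameter. *)
Lemma collinear_points_meet c d i : (c <= d)%N ->
  discs_meet (collinear_points i)
    (mkCDisc ((INR c + INR d) / 2) 0 ((INR d - INR c) / 2)) <-> (c <= i <= d)%N.
Proof.
move=> cd; have cdR : INR c <= INR d by apply: le_INR; apply/leP.
rewrite /discs_meet /in_disc /=; split.
  move=> [x [y [h1 h2]]]; have xi : x = INR i by nra.
  have y0 : y = 0 by nra.
  subst; apply/andP; split; apply/leP; apply: INR_le; nra.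
move=> /andP[/leP/le_INR ci /leP/le_INR id].
exists (INR i), 0; split; nra.
Qed.

Lemma collinear_points_colors n k col : (2 <= n)%coq_nat -> coloring n k col ->
  cf_discs n collinear_points col -> / ln 2 * ln (INR n) <= INR k.
Proof.
move=> n2 colk cf; have ln2 := ln_lt_2.
have lt_n : (n - 0 < 2 ^ size (iota 0 k))%N.
  apply: (@interval_cf_colors _ 0%N n col).
    by move=> i /= ltin; rewrite mem_iota add0n /=; apply/ltP; apply: colk; apply/ltP.
  move=> c d _ cd dn.
  have [||i [ltin [mi ui]]] := cf (mkCDisc ((INR c + INR d) / 2) 0 ((INR d - INR c) / 2)).
  - by rewrite /valid_disc /=; have := le_INR _ _ (elimT leP cd); lra.
  - by exists c; split; [lia|apply/collinear_points_meet => //; lia].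
  exists i; first exact/collinear_points_meet.
  move=> j cjd ji; apply/eqP; apply: ui; first by lia.
    exact/collinear_points_meet.
  exact/eqP.
rewrite size_iota subn0 in lt_n.
have powE : INR (2 ^ k)%N = 2 ^ k.
  by elim: k {colk lt_n} => //= k IH; rewrite expnS mult_INR IH.
have hn : ln (INR n) <= INR k * ln 2.
  rewrite -ln_pow; last lra.
  apply: ln_le; first by apply: lt_0_INR; lia.
  by rewrite -powE; apply: le_INR; lia.
apply: (Rmult_le_reg_l (ln 2)); first lra.
by rewrite -Rmult_assoc Rinv_r; lra.
Qed.

End Coloring.

Theorem theorem1p4 :
  (exists C : R, forall n : nat, (2 <= n)%nat ->
     forall F : nat -> cdisc, disc_family n F ->
     exists (k : nat) (col : nat -> nat),
       coloring n k col /\ INR k <= C * ln (INR n) /\ cf_discs n F col)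
  /\
  (exists c : R, 0 < c /\ forall n : nat, (2 <= n)%nat ->
     exists F : nat -> cdisc, disc_family n F /\
       forall (k : nat) (col : nat -> nat),
         coloring n k col -> cf_discs n F col -> c * ln (INR n) <= INR k).
Proof.
  split.
  - exists (/ ln 2 + / ln (16 / 15)).
    intros n n2 F famF. now apply Coloring.cf_coloring_log.
  - exists (/ ln 2). split.
    + apply Rinv_0_lt_compat. pose proof ln_lt_2. lra.
    + intros n n2. exists Coloring.collinear_points. split.
      * apply Coloring.collinear_points_family.
      * intros k col colk cf.
        now apply (Coloring.collinear_points_colors n2 colk cf).
Qed.
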